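(* Let $D=D(h_1,h_2)$ be a monocircular diagram with $h_1,h_2\ge2$. Let $(\mu_1,\mu_2)$ be a pair of integers with $2\le\mu_1\le h_1$, $2\le\mu_2\le h_2$, such that $\mu_1$ is even and $\mu_1<h_1$, or $\mu_2$ is even and $\mu_2<h_2$ (so that $V(\mu_1,\mu_2)$ defines an order two torsion element in the Khovanov homology of $D$). Let $\mu\geq 1$ be an odd integer such that $\mu<h_1$ (so that $V(\mu,0)$ defines an order two torsion element). Then $[V(\mu_1,\mu_2)]\neq[V(\mu,0)]$. Analogously, $[V(\mu_1,\mu_2)]\ne[V(0,\mu)]$ if $\mu\geq 1$ is odd and $\mu<h_2$.
   Context: Khovanov complex (coefficients in $\mathbb Z$). A Kauffman state of a diagram $D$ is a map $s:\mathrm{Cro}(D)\to\{A,B\}$ on the set of crossings. $sD$ denotes the collection of disjoint simple closed curves (''circles'') obtained by smoothing each crossing according to its label, where the $A$-smoothing joins the two regions swept by rotating the overstrand counterclockwise and the $B$-smoothing joins the other two; at each crossing one keeps a small chord (''scar'') joining the two resulting arcs, blue for an $A$-label and red for a $B$-label. An enhanced state is a state together with a sign $\pm$ on each circle of $sD$; $\theta(s)=\#(+)-\#(-)$, $i(s)=$ number of $B$-labels, $j(s)=i(s)+\theta(s)$. $C^{i,j}(D)$ is the free module generated by enhanced states with $i(s)=i$, $j(s)=j$. An enhanced state $t$ is adjacent to $s$ if $i(t)=i(s)+1$, $j(t)=j(s)$, the labels agree except at one crossing $x$ where $s(x)=A$, $t(x)=B$, and the signs of the common circles agree (so mergings are $(+,+)\mapsto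 +$, $(+,-),(-,+)\mapsto -$, and splittings are $+\mapsto(+,-)$ or $(-,+)$, $-\mapsto(-,-)$). With the crossings numbered, $d(s)=\sum_t (-1)^{k(s,t)}t$ over all $t$ adjacent to $s$, where $k(s,t)$ is the number of crossings previous to the change crossing $x$ having a $B$-label in $s$. $\underline{Kh}^{i,j}(D)$ is the homology of $(C^{*,j}(D),d)$ in degree $i$; classes are compared in $\bigoplus_{i,j}\underline{Kh}^{i,j}(D)$. Monocircular diagrams. A (blue) ladder of height $h$ in $sD$ is a maximal disc containing exactly two arcs of circles and $h$ parallel blue scars (steps) joining them. The monocircular diagram $D(h_1,h_2)$ is the standard diagram of the pretzel link $P(-1,\stackrel{(h_1)}{\dots},-1,h_2)$ (with the convention that the $A$-smoothing of a positive column yields two vertical arcs); with $s_A$ the all-$A$ state, $s_AD$ consists of one circle with two blue ladders $H_1,H_2$ of heights $h_1,h_2$ (one inside the circle, from the $h_1$ crossings of the $-1$ columns, or outside, and the other, from the $h_2$ column, on the opposite side, with interleaved endpoints) and no other scars. Crossings are ordered: first the steps of $H_1$ in order along the ladder, then those of $H_2$. Notation (initial state $s_A$). For nonempty $M_i\subset\{1,\dots,h_i\}$ with $|M_i|=\mu_i$, $s(M_1,M_2;\,)$ is the Kauffman state obtained from $s_A$ by changing the steps in $M_i$ of $H_i$ to red ($B$). Cutting both ladders (replacing the two arcs of each by caps at its two ends) leaves a single circle, which touches both ends of both ladders; the corresponding circle in the smoothing of $s(M_1,M_2;\,)$, touching the first (and last) red step of $H_i$, is denoted $C_i^0$. $s(\mu_1,\mu_2;C_i^{0-})$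 is the sum, over all $M_1,M_2$ with $|M_t|=\mu_t$, of the enhanced states with underlying state $s(M_1,M_2;\,)$ in which all circles have sign $+$ except $C_i^0$, which has sign $-$. For $\mu$ odd, $V(0,\mu):=s(1,\mu;C_2^{0-})$ if $1\le\mu<h_2$, and $V(\mu,0):=(-1)^\mu s(\mu,1;C_1^{0-})$ if $1\le\mu<h_1$ (known to define order two torsion elements). For $\mu_1,\mu_2\ge2$ as in the claim, $V(\mu_1,\mu_2)$ is the sum of the term $s(1+\mu_1,\mu_2;C_1^{0-})$, present only if $\mu_1$ is even and $\mu_1<h_1$, and the term $(-1)^{\mu_1}s(\mu_1,1+\mu_2;C_2^{0-})$, present only if $\mu_2$ is even and $\mu_2<h_2$. *)

(* Defs.v *)
From HB Require Import structures.
From mathcomp Require Import all_boot all_order all_algebra.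
(* boolp only serves to turn being a boundary into a boolean predicate. *)
From mathcomp Require Import boolp.

Set Implicit Arguments.
Unset Strict Implicit.
Unset Printing Implicit Defensive.

Import Order.TTheory GRing.Theory Num.Theory.
Local Open Scope ring_scope.
Local Open Scope quotient_scope.

(* Unoriented planar-diagram code.  [Crossing a b c d] lists the labels of the
   four edges met when turning counterclockwise around the crossing, starting
   from one end of the understrand: the understrand is a--c and the overstrand
   is b--d.  A label occurring at two crossing ends is an edge of the diagram
   joining these ends. *)
Record crossing (E : Type) := Crossing { end0 : E; end1 : E; end2 : E; end3 : E }.

Definition diagram (n : nat) (E : finType) := 'I_n -> crossing E.

(* The overstrand, rotated counterclockwise, sweeps the region between ends 1
   and 2 and the region between ends 3 and 0.  The A-smoothing joins these two
   regions, so that its two arcs are 0--1 and 2--3. *)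
Definition A_arcs (E : Type) (c : crossing E) : seq (E * E) :=
  [:: (end0 c, end1 c); (end2 c, end3 c)].
Definition B_arcs (E : Type) (c : crossing E) : seq (E * E) :=
  [:: (end1 c, end2 c); (end3 c, end0 c)].

Section Khovanov.

Variables (n : nat) (E : finType) (D : diagram n E).

(* A Kauffman state is given by the set of crossings labelled B. *)
Definition kstate := {set 'I_n}.

Definition smoothing_arcs (S : kstate) (x : 'I_n) : seq (E * E) :=
  if x \in S then B_arcs (D x) else A_arcs (D x).

Definition joined (S : kstate) : rel E := fun e f =>
  [exists x, ((e, f) \in smoothing_arcs S x) || ((f, e) \in smoothing_arcs S x)].

(* A circle of SD is represented by the set of edges of D it runs through. *)
Definition circle_of (S : kstate) (e : E) : {set E} :=
  [set f | connect (joined S) e f].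

Definition circles (S : kstate) : {set {set E}} := [set circle_of S e | e : E].

(* (S, N) is the state S with sign - on the circles in N and sign + on the
   other ones. *)
Definition enh : Type :=
  {p : kstate * {set {set E}} | p.2 \subset circles p.1}.
HB.instance Definition _ := Finite.on enh.

Definition st (s : enh) : kstate := (val s).1.
Definition neg (s : enh) : {set {set E}} := (val s).2.

Definition ideg (s : enh) : int := #|st s|%:Z.
Definition theta (s : enh) : int :=
  #|circles (st s) :\: neg s|%:Z - #|neg s|%:Z.
Definition jdeg (s : enh) : int := ideg s + theta s.

(* t is adjacent to s, with change crossing x *)
Definition adjacent_at (x : 'I_n) (s t : enh) : bool :=
  [&& x \notin st s, st t == x |: st s,
      ideg t == ideg s + 1, jdeg t == jdeg s &
      [forall C in circles (st s) :&: circles (st t),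
         (C \in neg s) == (C \in neg t)]].

(* The free abelian group on all enhanced states, i.e. the direct sum of the
   C^{i,j}(D). *)
Definition chain := {ffun enh -> int}.
HB.instance Definition _ := GRing.Zmodule.on chain.

Definition gen (s : enh) : chain := [ffun t => (t == s)%:R].

Definition kcount (s : enh) (x : 'I_n) : nat :=
  #|[set y : 'I_n | (y < x)%N & y \in st s]|.

(* For given s and t there is at most one change crossing x, so that the
   coefficient of t in d(s) is (-1)^{k(s,t)} if t is adjacent to s and 0
   otherwise. *)
Definition khd_gen (s : enh) : chain :=
  [ffun t => \sum_(x : 'I_n | adjacent_at x s t) (-1) ^+ kcount s x].

Definition khd (c : chain) : chain :=
  [ffun t => \sum_(s : enh) c s * khd_gen s t].

Definition bidegree (i j : int) : {pred chain} := fun c =>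
  [forall s, (c s != 0) ==> (ideg s == i) && (jdeg s == j)].

Definition cycle_pred (i j : int) : {pred chain} := fun c =>
  (c \in bidegree i j) && (khd c == 0).

Lemma khd_is_zmod : zmod_morphism khd.
Proof.
move=> c c'; apply/ffunP => t; rewrite !ffunE -sumrB.
by apply: eq_bigr => s _; rewrite !ffunE mulrBl.
Qed.
HB.instance Definition _ := GRing.isZmodMorphism.Build chain chain khd khd_is_zmod.

Fact bidegree_closed i j : zmod_closed (bidegree i j).
Proof.
split=> [|c c' /forallP hc /forallP hc'].
  by apply/forallP => s; rewrite ffunE eqxx.
apply/forallP => s; apply/implyP; rewrite !ffunE => nz.
case: (eqVneq (c s) 0) => [c0|]; last exact: (implyP (hc s)).
by apply: (implyP (hc' s)); move: nz; rewrite c0 sub0r oppr_eq0.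
Qed.
HB.instance Definition _ i j :=
  GRing.isZmodClosed.Build chain (bidegree i j) (bidegree_closed i j).

Fact cycle_closed i j : zmod_closed (cycle_pred i j).
Proof.
split=> [|c c' /andP[hc /eqP dc] /andP[hc' /eqP dc']].
  by apply/andP; rewrite rpred0 raddf0.
by apply/andP; rewrite rpredB // raddfB /= dc dc' subrr.
Qed.
HB.instance Definition _ i j :=
  GRing.isZmodClosed.Build chain (cycle_pred i j) (cycle_closed i j).

(* The kernel of d on C^{i,j}(D) *)
Definition kcycle (i j : int) : Type := {c : chain | c \in cycle_pred i j}.
HB.instance Definition _ i j := SubChoice.on (kcycle i j).
HB.instance Definition _ i j :=
  [SubChoice_isSubZmodule of kcycle i j by <:].

(* The image of d in C^{i,j}(D) *)
Definition boundary (i j : int) : {pred kcycle i j} := fun z =>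
  `[< exists2 w : chain, w \in bidegree (i - 1) j & val z = khd w >].

Fact boundary_closed i j : zmod_closed (@boundary i j).
Proof.
split=> [|z z' /asboolP[w hw zw] /asboolP[w' hw' zw']]; apply/asboolP.
  by exists 0; rewrite ?rpred0 ?raddf0.
by exists (w - w'); rewrite ?rpredB // !raddfB /= zw zw'.
Qed.
HB.instance Definition _ i j :=
  GRing.isZmodClosed.Build (kcycle i j) (@boundary i j) (@boundary_closed i j).

Definition Kh (i j : int) : zmodType := Quotient.quot (@boundary i j).

(* The component of a chain in C^{i,j}(D) *)
Definition component (i j : int) (c : chain) : chain :=
  [ffun s => if (ideg s == i) && (jdeg s == j) then c s else 0].

Lemma khd_component i j c :
  khd (component i j c) = component (i + 1) j (khd c).
Proof.
apply/ffunP => t; rewrite !ffunE.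
have dg s : khd_gen s t != 0 ->
    ((ideg s == i) && (jdeg s == j)) = ((ideg t == i + 1) && (jdeg t == j)).
  rewrite ffunE => nz.
  case: (pickP (fun x => adjacent_at x s t)) => [x|no].
    case/and5P=> _ _ /eqP-> /eqP-> _; congr andb.
    by rewrite (inj_eq (addIr 1)).
  by rewrite big_pred0 ?eqxx in nz.
case: ifP => ht; last rewrite big1 // => s _; last first.
  rewrite [component _ _ _ _]ffunE.
  by case: (eqVneq (khd_gen s t) 0) => [->|/dg ->]; rewrite ?mulr0 // ht mul0r.
apply: eq_bigr => s _; rewrite [component _ _ _ _]ffunE.
by case: (eqVneq (khd_gen s t) 0) => [->|/dg ->]; rewrite ?mulr0 // ht.
Qed.

Lemma component_cycle i j c :
  khd c = 0 -> component i j c \in cycle_pred i j.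
Proof.
move=> dc; apply/andP; split.
  by apply/forallP => s; rewrite ffunE; case: ifP; rewrite ?eqxx ?implybT.
by rewrite khd_component dc; apply/eqP/ffunP => s; rewrite !ffunE if_same.
Qed.

(* The class [c] of a cycle c in the direct sum of the Kh^{i,j}(D), given by
   the family of its components. *)
Definition Kh_class (c : chain) (dc : khd c = 0) : forall i j : int, Kh i j :=
  fun i j => \pi_(Kh i j) (Sub (component i j c) (component_cycle i j dc)
                             : kcycle i j).

Fact one_minus_subproof (S : kstate) (e : E) :
  [set circle_of S e] \subset circles S.
Proof. by apply/subsetP => C /set1P ->; apply: imset_f. Qed.

(* The state S with sign - on the circle running through e and + elsewhere *)
Definition one_minus (S : kstate) (e : E) : enh :=
  exist _ (S, [set circle_of S e]) (one_minus_subproof S e).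

End Khovanov.

Section Monocircular.

Variables h1 h2 : nat.

(* The 2 (h1 + h2) edges of D(h1, h2), for h1 + h2 > 0.  They are numbered
   cyclically along the unique circle of s_A D: inZp below reduces labels
   modulo 2 (h1 + h2). *)
Definition mono_edge := 'I_((h1 + h2).*2.-1.+1).

(* The standard diagram of P(-1, ..., -1, h2) has, from left to right, h1
   columns with one negative crossing each, numbered 0, ..., h1 - 1, and one
   column of h2 positive crossings, numbered 0, ..., h2 - 1 downwards.
   - top k and bot k are the edges at the upper left and lower left ends of
     the k-th negative column, and at the upper right and lower right ends of
     the (k-1)-th one; the edges top 0 and bot 0 run around the diagram to the
     upper right and lower right ends of the last column;
   - lft k and rgt k are the edges at the upper left and upper right ends of
     the k-th positive crossing, and at the lower left and lower right ends of
     the (k-1)-th one.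
   Thus top h1 = lft 0, lft h2 = bot h1, bot 0 = rgt h2 and rgt 0 = top 0. *)
Definition top (k : nat) : mono_edge := inZp k.
Definition lft (k : nat) : mono_edge := inZp (h1 + k).
Definition bot (k : nat) : mono_edge := inZp (h1 + h2 + (h1 - k)).
Definition rgt (k : nat) : mono_edge := inZp (h1 + h2 + h1 + (h2 - k)).

(* The A-smoothing of a positive crossing consists of two vertical arcs, that
   of a negative one of two horizontal arcs.  So the crossings of the negative
   columns are the steps of the ladder H_1 and those of the last column are
   the steps of the ladder H_2. *)
Definition mono : diagram (h1 + h2) mono_edge := fun x =>
  match split x with
  | inl k => Crossing (bot k) (bot k.+1) (top k.+1) (top k)
  | inr k => Crossing (rgt k.+1) (rgt k) (lft k) (lft k.+1)
  end.

(* s(M1, M2; ) *)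
Definition mono_state (M1 : {set 'I_h1}) (M2 : {set 'I_h2}) : kstate (h1 + h2) :=
  [set lshift h2 k | k in M1] :|: [set rshift h1 k | k in M2].

(* The enhanced states with underlying state s(M1, M2; ), sign - on the circle
   running through e and + elsewhere, summed over |M1| = mu1 and |M2| = mu2 *)
Definition mono_sum (mu1 mu2 : nat) (e : mono_edge) : chain mono :=
  \sum_(M1 : {set 'I_h1} | #|M1| == mu1)
    \sum_(M2 : {set 'I_h2} | #|M2| == mu2)
      gen (one_minus mono (mono_state M1 M2) e).

(* C_i^0 is the circle that reaches the end of the ladder H_i, hence the one
   through the edge leading from outside of H_i to its first step; that edge is
   top 0 for H_1 and lft 0 for H_2.  When M_i is nonempty, this circle touches
   the first and the last red steps of H_i on their outer sides. *)
Definition sum_C1 (mu1 mu2 : nat) : chain mono := mono_sum mu1 mu2 (top 0).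
Definition sum_C2 (mu1 mu2 : nat) : chain mono := mono_sum mu1 mu2 (lft 0).

(* V(0, mu) and V(mu, 0) *)
Definition V_left0 (mu : nat) : chain mono := sum_C2 1 mu.
Definition V_right0 (mu : nat) : chain mono := sum_C1 mu 1 *~ (-1) ^+ mu.

(* V(mu1, mu2) for mu1, mu2 >= 2 *)
Definition V (mu1 mu2 : nat) : chain mono :=
  (if ~~ odd mu1 && (mu1 < h1)%N then sum_C1 mu1.+1 mu2 else 0) +
  (if ~~ odd mu2 && (mu2 < h2)%N then sum_C2 mu1 mu2.+1 *~ (-1) ^+ mu1 else 0).

End Monocircular.

(* Main.v *)
Require Import Defs.
From HB Require Import structures.
From mathcomp Require Import all_boot all_order all_algebra.
From mathcomp Require Import zify boolp.

Set Implicit Arguments.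
Unset Strict Implicit.
Unset Printing Implicit Defensive.

(** The classes are told apart by a functional that is even on boundaries.
    Fix a Kauffman state S, given by its set of red steps, with at least two
    red steps in each ladder, and let [coef_sum S] add up the coefficients of
    the enhanced states over S with exactly one minus sign.

    Making any step x of S blue again leaves a red step in both ladders, so
    that the last step of every path to S is a splitting.  By the degrees, an
    enhanced state over S with one minus sign is only reached from the state
    without minus signs, and then + splits into (+,-) and (-,+): the two
    enhanced states reached over S have one minus sign each, and enter d with
    the same sign.  Hence [coef_sum S] is even on the image of d
    ([coef_sum_khd]).

    On the other hand, [coef_sum S] of the sum of all s(M1, M2; C^0-) with
    prescribed numbers of red steps is 1 if S has these numbers, and else 0
    ([coef_sum_mono_sum]).  If S has the numbers of red steps of a
    term present in V(mu1, mu2), the functional is 1 or -1 on V(mu1, mu2); it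
    vanishes on V(mu, 0) and V(0, mu), whose states have a single red step in
    one of the ladders ([separated]).

    That these chains are cycles holds for s(a, b; C^0-) with any positive a
    and b ([khd_mono_sum]).  A target of d has minus signs on the outer circle
    C^0 and on one inner circle, which lies between two consecutive red steps.
    It arises exactly by making one of these two steps red last, and the two
    contributions have opposite signs.

    Both arguments need the circles of a state.  Number the levels of both
    ladders together by 0, ..., h1 + h2, the level h1 standing for the end of
    H_1 as well as for the beginning of H_2.  If both ladders contain red
    steps, the circle through an edge is determined by the number of red steps
    below its level ([connE]), and only the numbers 0, |M1| and |M1| + |M2|
    give the same circle, the outer one. *)

(** * Merging consecutive labels *)

(** The label of the circle found after [c] red steps, when [a] of the [m] red
    steps belong to the first ladder: the counts 0, [a] and [m] all lead to the
    outer circle, which gets the label 0. *)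
Definition fuse (a m c : nat) : nat := if (c == a) || (c == m) then 0 else c.

Lemma fuse_eq a m c c' : 0 < a -> 0 < m ->
  (fuse a m c == fuse a m c') =
  (c == c') || (c \in [:: 0; a; m]) && (c' \in [:: 0; a; m]).
Proof.
rewrite /fuse !inE => a0 m0.
by case: (eqVneq c a) => ca; case: (eqVneq c m) => cm;
   case: (eqVneq c' a) => ca'; case: (eqVneq c' m) => cm' /=; lia.
Qed.

(** Removing the red step number [r], counted from 0, turns a count [c] into
    [c - (r < c)], which confuses the counts [r] and [r.+1] only. *)
Lemma collapse_eq r c c' :
  (c - (r < c) == c' - (r < c')) =
  (c == c') || (c \in [:: r; r.+1]) && (c' \in [:: r; r.+1]).
Proof.
by rewrite !inE; case: (ltnP r c) => rc; case: (ltnP r c') => rc' /=;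
   rewrite ?subn0 ?subn1; lia.
Qed.

Lemma collapse_outer a m r c (a' := a - (r < a)) :
  0 < a' < m.-1 -> r < m -> c <= m ->
  (c - (r < c) \in [:: 0; a'; m.-1]) =
  (c \in [:: 0; a; m]) ||
  (c \in [:: r; r.+1]) && ((r \in [:: 0; a; m]) || (r.+1 \in [:: 0; a; m])).
Proof.
move=> am rm cm.
have z : 0 = 0 - (r < 0) by [].
have m' : m.-1 = m - (r < m) by rewrite rm subn1.
rewrite !in_cons !in_nil !orbF /a' {1}z m' !collapse_eq !inE.
case: (eqVneq c r) => [->|_]; first by clear; lia.
by case: (eqVneq c r.+1) => [->|_]; clear; lia.
Qed.

(** On labels, removing a red step merges the labels on its two sides and
    keeps all others apart. *)
Lemma fuse_merge a m r c c' (a' := a - (r < a)) :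
  0 < a' < m.-1 -> r < m -> c <= m -> c' <= m ->
  (fuse a' m.-1 (c - (r < c)) == fuse a' m.-1 (c' - (r < c'))) =
  (fuse a m c == fuse a m c') ||
  (fuse a m c \in [:: fuse a m r; fuse a m r.+1]) &&
  (fuse a m c' \in [:: fuse a m r; fuse a m r.+1]).
Proof.
move=> am rm cm cm'.
have [a0 m0] : 0 < a /\ 0 < m by clear -am rm; rewrite /a' in am; lia.
have [a0' m0'] : 0 < a' /\ 0 < m.-1.
  by case/andP: am => a1 /(leq_trans _)->.
have E x : (fuse a m x \in [:: fuse a m r; fuse a m r.+1]) =
    (x \in [:: r; r.+1]) || (x \in [:: 0; a; m]) &&
      ((r \in [:: 0; a; m]) || (r.+1 \in [:: 0; a; m])).
  rewrite in_cons mem_seq1 !fuse_eq // [x \in [:: r; _]]in_cons mem_seq1.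
  by case: (x == r); case: (x == _); case: (x \in _); case: (r \in _);
     case: (r.+1 \in _).
rewrite !E !fuse_eq // !collapse_outer // collapse_eq.
by case: (c == c') => //=; do ?[case: (_ \in _)].
Qed.

(** The two sides of a red step lie on different circles, unless it is the
    only red step of its ladder. *)
Lemma fuse_neq a m r (a' := a - (r < a)) :
  0 < a' < m.-1 -> r < m -> fuse a m r != fuse a m r.+1.
Proof. by rewrite /a' => am rm; rewrite fuse_eq ?inE; lia. Qed.

(** * Ranks in a set of steps *)

Section Rank.
Variable n : nat.
Implicit Types (S : {set 'I_n}) (x : 'I_n).

Definition rank S (p : nat) : nat := #|[set y in S | y < p]|.

Lemma rank0 S : rank S 0 = 0.
Proof.
by apply/eqP; rewrite cards_eq0; apply/eqP/setP => y; rewrite !inE andbF.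
Qed.

Lemma rank_max S : rank S n = #|S|.
Proof. by apply: eq_card => y; rewrite !inE ltn_ord andbT. Qed.

Lemma rank_le_card S p : rank S p <= #|S|.
Proof.
by apply: subset_leq_card; apply/subsetP => y; rewrite inE => /andP[].
Qed.

Lemma rankS S x : rank S x.+1 = rank S x + (x \in S).
Proof.
rewrite /rank; case: (boolP (x \in S)) => xS; last first.
  rewrite addn0; apply: eq_card => y; rewrite !inE ltnS leq_eqVlt val_eqE.
  by case: (eqVneq y x) => [->|] //=; rewrite (negbTE xS).
rewrite addn1 (cardsD1 x) !inE xS ltnSn add1n; congr _.+1.
apply: eq_card => y; rewrite !inE ltnS leq_eqVlt val_eqE.
by case: (eqVneq y x) => [->|] //=; rewrite ltnn andbF.
Qed.

Lemma leq_rank S p p' : p <= p' -> rank S p <= rank S p'.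
Proof.
move=> le; apply: subset_leq_card; apply/subsetP => y; rewrite !inE.
by case/andP=> -> /= /leq_trans; apply.
Qed.

Lemma rank_attained S c : c <= #|S| -> exists2 p, p <= n & rank S p = c.
Proof.
suff H k : k <= n -> c <= rank S k -> exists2 p, p <= n & rank S p = c.
  by rewrite -rank_max; apply: H.
elim: k => [|k IH] kn cle.
  by exists 0 => //; move: cle; rewrite rank0 leqn0 => /eqP.
move: (rankS S (Ordinal kn)) cle => /= E.
case: (ltnP (rank S k) c) => [ltc lec|lec _].
  by exists k.+1 => //; move: ltc lec; rewrite E; case: (_ \in _); lia.
by apply: IH => //; apply: ltnW.
Qed.

Lemma rank_nth S r : r < #|S| -> exists2 x, x \in S & rank S x = r.
Proof.
move=> rS.
suff H k : k <= n -> r < rank S k -> exists2 x, x \in S & rank S x = r.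
  by move: rS; rewrite -rank_max; apply: H.
elim: k => [|k IH] kn; first by rewrite rank0.
move: (rankS S (Ordinal kn)) => /= E.
case: (ltnP r (rank S k)) => [ltc _|lec].
  by apply: IH => //; apply: ltnW.
rewrite E; case: (boolP (_ \in _)) => [kS|]; last by rewrite addn0 ltnNge lec.
rewrite addn1 ltnS => ler; exists (Ordinal kn) => //=.
by apply/eqP; rewrite eqn_leq lec ler.
Qed.

Lemma rank_lt S x y : x \in S -> x < y -> rank S x < rank S y.
Proof. by move=> xS /(leq_rank S); rewrite rankS xS addn1. Qed.

Lemma rank_inj S : {in S &, injective (fun x => rank S x)}.
Proof.
move=> x y xS yS /eqP; apply: contraTeq.
rewrite -(inj_eq val_inj) /= neq_ltn neq_ltn.
by case/orP=> [/(rank_lt xS)|/(rank_lt yS)] ->; rewrite ?orbT.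
Qed.

Lemma rank_lt_card S x : x \in S -> rank S x < #|S|.
Proof. by rewrite -(rank_max S) => xS; apply: rank_lt. Qed.

Lemma ltn_rank S x p : x \in S -> (rank S x < rank S p) = (x < p).
Proof.
by move=> xS; case: (ltnP x p) => [/(rank_lt xS)//|/(leq_rank S)]; lia.
Qed.

Lemma rank_setD1 S x p :
  x \in S -> rank (S :\ x) p = rank S p - (rank S x < rank S p).
Proof.
move=> xS; rewrite (ltn_rank _ xS) /rank.
have -> : [set y in S :\ x | y < p] = [set y in S | y < p] :\ x.
  by apply/setP => y; rewrite !inE andbA.
by rewrite (cardsD1 x [set y in S | y < p]) inE xS /= addKn.
Qed.

End Rank.

(** * Labels of the edges *)

Section Circles.
Variables h1 h2 : nat.
Local Notation n := (h1 + h2).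
Local Notation E := (mono_edge h1 h2).
Local Notation D := (@mono h1 h2).
Local Notation top := (top h1 h2).
Local Notation bot := (bot h1 h2).
Local Notation lft := (lft h1 h2).
Local Notation rgt := (rgt h1 h2).
Implicit Types (S : {set 'I_n}) (x : 'I_n) (u v : E).

(** The level of an edge, the levels of H_2 being shifted by [h1].  The two
    corners [bot h1 = lft h2] and [bot 0 = rgt h2] belong to both ladders; the
    choice made for them is immaterial, as the outer circle runs through both
    ends of both ladders. *)
Definition level v : nat :=
  if v <= n then v : nat else if v <= n + h1 then n + h1 - v else n + n + h1 - v.

(** Both ladders contain red steps. *)
Definition cuts_both S := 0 < rank S h1 < #|S|.

Definition rank_label S c := fuse (rank S h1) #|S| c.
Definition label S v := rank_label S (rank S (level v)).

Lemma label_id S c : rank_label S c != 0 -> rank_label S c = c.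
Proof. by rewrite /rank_label /fuse; case: ifP. Qed.

Lemma rank_label0 S : rank_label S 0 = 0.
Proof. by rewrite /rank_label /fuse; case: ifP. Qed.

Lemma rank_label_h1 S : rank_label S (rank S h1) = 0.
Proof. by rewrite /rank_label /fuse eqxx. Qed.

Lemma rank_label_n S : rank_label S (rank S n) = 0.
Proof. by rewrite /rank_label /fuse rank_max eqxx orbT. Qed.

Lemma interior_label S j :
  0 < j < #|S| -> j != rank S h1 -> rank_label S j = j.
Proof.
by case/andP=> _ jm ja; rewrite /rank_label /fuse (negbTE ja) (ltn_eqF jm).
Qed.

Section Connect.
Variable S : {set 'I_n}.
Hypothesis cutS : cuts_both S.

Lemma h1_gt0 : 0 < h1.
Proof.
case/andP: cutS => + _; apply: contraTT; rewrite -leqNgt -leqNgt => h.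
by rewrite -(rank0 S); apply: leq_rank.
Qed.

Lemma h2_gt0 : 0 < h2.
Proof.
case/andP: cutS => _; apply: contraTT; rewrite -leqNgt -leqNgt => h.
by rewrite -rank_max; apply: leq_rank; lia.
Qed.

Lemma val_inZp k : k < n.*2 -> (inZp k : E) = k :> nat.
Proof. by move=> kn; rewrite /= modn_small //; move: kn h1_gt0; lia. Qed.

Lemma val_top k : k <= h1 -> top k = k :> nat.
Proof. by move=> kh; apply: val_inZp; have := h2_gt0; lia. Qed.

Lemma val_lft k : k <= h2 -> lft k = h1 + k :> nat.
Proof. by move=> kh; apply: val_inZp; have := h1_gt0; lia. Qed.

Lemma val_bot k : k <= h1 -> bot k = n + (h1 - k) :> nat.
Proof. by move=> kh; apply: val_inZp; have := h2_gt0; lia. Qed.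

Lemma val_rgt k : 0 < k <= h2 -> rgt k = n + h1 + (h2 - k) :> nat.
Proof. by move=> kh; apply: val_inZp; lia. Qed.

Lemma rgt0 : rgt 0 = top 0.
Proof.
apply: ord_inj; rewrite (val_top (leq0n _)) /= subn0 -addnA addnn.
by rewrite prednK ?modnn //; have := h1_gt0; lia.
Qed.

Lemma lft0 : lft 0 = top h1.
Proof. by rewrite /Defs.lft addn0. Qed.

Lemma lft_h2 : lft h2 = bot h1.
Proof. by rewrite /Defs.bot subnn addn0. Qed.

Lemma rgt_h2 : rgt h2 = bot 0.
Proof. by rewrite /Defs.bot /Defs.rgt subnn addn0 subn0. Qed.

Lemma label_top k : k <= h1 -> label S (top k) = rank_label S (rank S k).
Proof.
by move=> kh; rewrite /label /level val_top // (leq_trans kh) ?leq_addr.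
Qed.

Lemma label_lft k :
  k <= h2 -> label S (lft k) = rank_label S (rank S (h1 + k)).
Proof. by move=> kh; rewrite /label /level val_lft // leq_add2l kh. Qed.

Lemma label_bot k : k <= h1 -> label S (bot k) = rank_label S (rank S k).
Proof.
move=> kh; rewrite /label /level val_bot //.
case: (eqVneq k h1) => [->|ne].
  by rewrite subnn addn0 leqnn rank_label_h1 rank_label_n.
have -> : n + (h1 - k) <= n = false by lia.
have -> : n + (h1 - k) <= n + h1 by lia.
by congr (rank_label S (rank S _)); lia.
Qed.

Lemma label_rgt k :
  k <= h2 -> label S (rgt k) = rank_label S (rank S (h1 + k)).
Proof.
case: k => [_|k kh].
  by rewrite rgt0 label_top // addn0 rank0 rank_label0 rank_label_h1.
case: (eqVneq k.+1 h2) => [e|ne].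
  by rewrite e rgt_h2 label_bot // rank0 rank_label0 rank_label_n.
rewrite /label /level val_rgt //.
have -> : n + h1 + (h2 - k.+1) <= n = false by lia.
have -> : n + h1 + (h2 - k.+1) <= n + h1 = false by lia.
by congr (rank_label S (rank S _)); lia.
Qed.

(** A blue step joins edges on consecutive levels with the same number of red
    steps below, a red one joins edges on the same level. *)
Lemma joined_label u v : joined D S u v -> label S u = label S v.
Proof.
wlog /existsP[x uv] : u v / [exists x, (u, v) \in smoothing_arcs D S x].
  move=> W /existsP[x xuv]; have J : joined D S u v by apply/existsP; exists x.
  case/orP: xuv => uv; first by apply: W => //; apply/existsP; exists x.
  apply/esym/W; first by apply/existsP; exists x.
  by apply/existsP; exists x; rewrite uv.
move=> _; move: uv; rewrite /smoothing_arcs /mono.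
have := rankS S x; have := splitK x; case: (split x) => k <- /=.
  have kk := ltn_ord k; have kk' := ltnW kk => rk.
  by case: ifP => kS; rewrite !inE !xpair_eqE => /orP[]/andP[/eqP-> /eqP->];
     rewrite ?(label_top kk) ?(label_top kk') ?(label_bot kk) ?(label_bot kk')
       // rk kS addn0.
have kk := ltn_ord k; have kk' := ltnW kk => rk.
by case: ifP => kS; rewrite !inE !xpair_eqE => /orP[]/andP[/eqP-> /eqP->];
   rewrite ?(label_lft kk) ?(label_lft kk') ?(label_rgt kk) ?(label_rgt kk')
     // addnS rk kS addn0.
Qed.

(** * The circles of a state *)

Local Notation "u ~~> v" := (connect (joined D S) u v) (at level 70).

Lemma conn_sym u v : (u ~~> v) = (v ~~> u).
Proof.
by apply: sym_connect_sym => {}u {}v; apply: eq_existsb => x; rewrite orbC.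
Qed.

Lemma conn_label u v : u ~~> v -> label S u = label S v.
Proof.
case/connectP=> p + ->.
by elim: p u => //= w p IH u /andP[/joined_label->]; apply: IH.
Qed.

Lemma conn_arc x u v :
  ((u, v) \in smoothing_arcs D S x) || ((v, u) \in smoothing_arcs D S x) ->
  u ~~> v.
Proof. by move=> uv; apply/connect1/existsP; exists x. Qed.

Lemma arcs_H1 (k : 'I_h1) : if lshift h2 k \in S
  then (top k ~~> bot k) && (top k.+1 ~~> bot k.+1)
  else (top k ~~> top k.+1) && (bot k ~~> bot k.+1).
Proof.
case: ifP => kS; apply/andP; split; apply: (@conn_arc (lshift h2 k));
  by rewrite /smoothing_arcs /mono kS (unsplitK (inl k)) !inE /= ?eqxx ?orbT.
Qed.

Lemma arcs_H2 (k : 'I_h2) : if rshift h1 k \in S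
  then (lft k ~~> rgt k) && (lft k.+1 ~~> rgt k.+1)
  else (lft k ~~> lft k.+1) && (rgt k ~~> rgt k.+1).
Proof.
case: ifP => kS; apply/andP; split; apply: (@conn_arc (rshift h1 k));
  by rewrite /smoothing_arcs /mono kS (unsplitK (inr k)) !inE /= ?eqxx ?orbT.
Qed.

(** A red step joins the two sides [f] and [g] of a ladder on its two levels,
    and blue steps carry the connection to all other levels. *)
Lemma ladder_sides h (f g : nat -> E) (isred : 'I_h -> bool) k0 :
  (forall k : 'I_h, if isred k then (f k ~~> g k) && (f k.+1 ~~> g k.+1)
                    else (f k ~~> f k.+1) && (g k ~~> g k.+1)) ->
  isred k0 -> forall k, k <= h -> f k ~~> g k.
Proof.
move=> H red0.
have step (k : 'I_h) : (f k ~~> g k) = (f k.+1 ~~> g k.+1).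
  have := H k; case: ifP => _ /andP[]; first by move=> -> ->.
  move=> ff gg; rewrite (same_connect conn_sym ff).
  exact: (same_connect_r conn_sym gg).
have base : f k0 ~~> g k0 by have := H k0; rewrite red0 => /andP[].
suff all k : k <= h -> (f k ~~> g k) = (f 0 ~~> g 0).
  by move=> k kh; rewrite all // -(all k0) // ltnW.
by elim: k => // k IH kh; rewrite -(step (Ordinal kh)) IH // ltnW.
Qed.

Lemma top_bot k : k <= h1 -> top k ~~> bot k.
Proof.
case/andP: cutS => + _.
rewrite card_gt0 => /set0Pn[x]; rewrite inE => /andP[xS xh].
pose red (k : 'I_h1) := lshift h2 k \in S.
apply: (@ladder_sides _ _ _ red (Ordinal xh) arcs_H1).
by rewrite /red (_ : lshift _ _ = x) //; apply: val_inj.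
Qed.

Lemma lft_rgt k : k <= h2 -> lft k ~~> rgt k.
Proof.
have [x xS rx] : exists2 x, x \in S & rank S x = rank S h1.
  by apply: rank_nth; case/andP: cutS.
have hx : h1 <= x by rewrite leqNgt -(ltn_rank _ xS) rx ltnn.
have kx : x - h1 < h2 by have := ltn_ord x; lia.
pose red (k : 'I_h2) := rshift h1 k \in S.
apply: (@ladder_sides _ _ _ red (Ordinal kx) arcs_H2).
rewrite /red (_ : rshift _ _ = x) //.
by apply: val_inj; rewrite /= subnKC.
Qed.

(** The edges [top k] and [lft k], numbered together by their levels, serve as
    representatives: the side [bot] or [rgt] of a ladder is connected to the
    opposite side. *)
Definition upper (p : nat) : E := inZp p.

Lemma edge_upper v : exists2 p,
  p <= n & upper p ~~> v /\ label S v = rank_label S (rank S p).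
Proof.
have vE : v < n.*2 by have := ltn_ord v; have := h1_gt0; lia.
case: (leqP v n) => [vn|nv].
  by exists (v : nat) => //; rewrite /upper valZpK /label /level vn connect0.
case: (leqP v (n + h1)) => [vb|bv].
  have kh : n + h1 - v <= h1 by lia.
  have -> : v = bot (n + h1 - v).
    by apply: ord_inj; rewrite (val_bot kh); clear -nv vb; lia.
  exists (n + h1 - v); first by lia.
  by rewrite (label_bot kh); split=> //; apply: top_bot.
have kh : 0 < n + n - v <= h2 by lia.
have -> : v = rgt (n + n - v).
  by apply: ord_inj; rewrite (val_rgt kh); clear -vE bv; lia.
case/andP: kh => _ kh; exists (h1 + (n + n - v)); first by lia.
by rewrite (label_rgt kh); split=> //; apply: lft_rgt.
Qed.

Lemma conn_upper p p' :
  p <= p' <= n -> rank S p = rank S p' -> upper p ~~> upper p'.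
Proof.
case/andP; elim: p' => [|q IH]; first by rewrite leqn0 => /eqP->.
rewrite leq_eqVlt => /predU1P[->|pq] // qn e.
have := rankS S (Ordinal qn) => /= eq.
have le1 : rank S p <= rank S q by exact: leq_rank.
have qS : Ordinal qn \notin S.
  by apply/negP => qS; move: eq; rewrite qS -e; lia.
have {}e : rank S p = rank S q by rewrite e eq (negbTE qS) addn0.
apply: connect_trans (IH pq (ltnW qn) e) _.
case: (ltnP q h1) => [qh|hq].
  have := arcs_H1 (Ordinal qh).
  rewrite (_ : lshift _ _ = Ordinal qn) ?(negbTE qS); last exact: val_inj.
  by case/andP.
have qh : q - h1 < h2 by lia.
have := arcs_H2 (Ordinal qh).
rewrite (_ : rshift _ _ = Ordinal qn) ?(negbTE qS).
  by rewrite /Defs.lft /= addnS subnKC //; case/andP.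
by apply: val_inj; rewrite /= subnKC.
Qed.

(** The outer circle is closed up at the corners: [top 0] is [rgt 0], opposite
    to [lft 0] on the level [h1], and the edge [upper n] is [lft h2], that is
    [bot h1], opposite to [top h1]. *)
Lemma conn_outer : upper 0 ~~> upper h1 /\ upper 0 ~~> upper n.
Proof.
have h : upper 0 ~~> upper h1.
  by have := lft_rgt (leq0n _); rewrite rgt0 conn_sym lft0.
split=> //; apply: connect_trans h _; have := top_bot (leqnn _).
by rewrite -lft_h2.
Qed.

Lemma conn_outer_label p :
  p <= n -> rank_label S (rank S p) = 0 -> upper 0 ~~> upper p.
Proof.
move=> pn; have [c1 c2] := conn_outer.
rewrite /rank_label /fuse; case: eqP => [e _|_].
  apply: connect_trans c1 _.
  case/orP: (leq_total p h1) => le; first rewrite conn_sym;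
    by apply: conn_upper; rewrite ?le ?leq_addr.
case: eqP => [e _|_ /= e]; last by apply: conn_upper; rewrite ?rank0 ?pn.
apply: connect_trans c2 _; rewrite conn_sym.
by apply: conn_upper; rewrite ?pn ?leqnn ?rank_max.
Qed.

Lemma connE u v : (u ~~> v) = (label S u == label S v).
Proof.
apply/idP/eqP => [/conn_label //|].
have [p pn [pu ->]] := edge_upper u; have [q qn [qv ->]] := edge_upper v => e.
rewrite -(same_connect conn_sym pu) -(same_connect_r conn_sym qv).
case: (eqVneq (rank_label S (rank S p)) 0) => [z|nz].
  apply: (@connect_trans _ _ (upper 0)).
    by rewrite conn_sym conn_outer_label.
  by apply: conn_outer_label; rewrite -?e.
have {}e : rank S p = rank S q.
  by rewrite -(label_id nz) e label_id // -e.
case/orP: (leq_total p q) => le; last rewrite conn_sym;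
  by apply: conn_upper; rewrite ?le.
Qed.

End Connect.

Definition rank_circle S c : {set E} := [set v | label S v == rank_label S c].

Lemma circle_ofE S v :
  cuts_both S -> circle_of D S v = rank_circle S (rank S (level v)).
Proof. by move=> cS; apply/setP => u; rewrite !inE connE // eq_sym. Qed.

Lemma level_attained S c :
  cuts_both S -> c <= #|S| -> exists v, rank S (level v) = c.
Proof.
move=> cS /rank_attained[p pn <-]; exists (inZp p).
have e : (inZp p : E) = p :> nat.
  by apply: (val_inZp cS); have := h1_gt0 cS; lia.
by rewrite /level e pn.
Qed.

Lemma rank_circle_in S c :
  cuts_both S -> c <= #|S| -> rank_circle S c \in circles D S.
Proof.
by move=> cS /(level_attained cS)[v <-]; rewrite -circle_ofE //; apply: imset_f.
Qed.

Lemma circlesP S C : cuts_both S -> C \in circles D S ->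
  exists2 c, c <= #|S| & C = rank_circle S c.
Proof.
move=> cS /imsetP[v _ ->]; exists (rank S (level v)); last exact: circle_ofE.
exact: rank_le_card.
Qed.

Lemma rank_circle_eq S c c' : cuts_both S -> c <= #|S| ->
  (rank_circle S c == rank_circle S c') = (rank_label S c == rank_label S c').
Proof.
move=> cS cle; apply/eqP/eqP => [|e]; last by rewrite /rank_circle e.
have [v vc] := level_attained cS cle.
by move=> /setP/(_ v); rewrite !inE /label vc eqxx => /esym/eqP.
Qed.

Lemma rank_circle_label S c : rank_circle S (rank_label S c) = rank_circle S c.
Proof.
suff e : rank_label S (rank_label S c) = rank_label S c.
  by rewrite /rank_circle e.
case: (eqVneq (rank_label S c) 0) => [->|/label_id e]; last by rewrite e.
exact: rank_label0.
Qed.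

Lemma circle_outer S e :
  cuts_both S -> label S e = 0 -> circle_of D S e = rank_circle S 0.
Proof.
move=> cS l0; rewrite circle_ofE //; apply/eqP.
by rewrite rank_circle_eq ?rank_le_card // rank_label0 -l0.
Qed.

(** Among the ranks 0, ..., |S| - 1 only the number [rank S h1] of red steps in
    H_1 repeats a label, that of the outer circle. *)
Lemma card_circles S : cuts_both S -> #|circles D S| = #|S|.-1.
Proof.
move=> cS; have [a0 am] := andP cS.
have -> : circles D S =
    [set rank_circle S (nat_of_ord c) | c in [set~ Ordinal am]].
  apply/setP => C; apply/idP/imsetP => [/(circlesP cS)[c cle ->]|[c _ ->]].
    have cl : rank_label S c < #|S|.
      rewrite /rank_label /fuse; case: ifP => [_|/norP[_ ne]].
        exact: leq_ltn_trans am.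
      by rewrite ltn_neqAle ne.
    exists (Ordinal cl); last by rewrite /= rank_circle_label.
    rewrite !inE -val_eqE /= /rank_label /fuse; case: ifP => [_|/norP[]] //.
    by rewrite eq_sym -lt0n.
  by apply: rank_circle_in => //; apply: ltnW.
rewrite card_in_imset; first by rewrite cardsC1 card_ord.
move=> c c'; rewrite !inE -!val_eqE /= => cn cn' /eqP.
rewrite rank_circle_eq ?(ltnW (ltn_ord _)) // /rank_label /fuse.
rewrite (negbTE cn) (negbTE cn') /=.
by rewrite (ltn_eqF (ltn_ord c)) (ltn_eqF (ltn_ord c')) => /eqP/val_inj.
Qed.

(** * Changing one step *)

(** The circle of rank [c] runs along the red step [x]. *)
Definition touched S x c :=
  rank_label S c \in [:: rank_label S (rank S x); rank_label S (rank S x).+1].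

Section Merge.
Variables (S : {set 'I_n}) (x : 'I_n).
Hypotheses (xS : x \in S) (cut' : cuts_both (S :\ x)).

Lemma card_setD1 : #|S| = #|S :\ x|.+1.
Proof. by rewrite (cardsD1 x) xS add1n. Qed.

Lemma cuts_bothD1 : cuts_both S.
Proof.
move: cut'; rewrite /cuts_both rank_setD1 // card_setD1.
by case: (_ < rank S h1) => /=; lia.
Qed.
Let cutS := cuts_bothD1.

Lemma label_merge c c' : c <= #|S| -> c' <= #|S| ->
  (rank_label (S :\ x) (c - (rank S x < c)) ==
     rank_label (S :\ x) (c' - (rank S x < c'))) =
  (rank_label S c == rank_label S c') || touched S x c && touched S x c'.
Proof.
move=> cS cS'; have e : #|S :\ x| = #|S|.-1 by rewrite card_setD1.
rewrite /rank_label rank_setD1 // e; apply: fuse_merge => //.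
  by rewrite -e -rank_setD1.
exact: rank_lt_card.
Qed.

Lemma label_neq : rank_label S (rank S x) != rank_label S (rank S x).+1.
Proof.
have e : #|S :\ x| = #|S|.-1 by rewrite card_setD1.
by apply: fuse_neq; [rewrite -e -rank_setD1 | apply: rank_lt_card].
Qed.

Lemma rank_circle_untouched c : c <= #|S| -> ~~ touched S x c ->
  rank_circle S c = rank_circle (S :\ x) (c - (rank S x < c)).
Proof.
move=> cS tc; apply/setP => v.
rewrite !inE /label rank_setD1 // label_merge ?rank_le_card //.
by rewrite (negbTE tc) andbF orbF.
Qed.

(** A circle of [S] along [x] is not a circle of [S :\ x]: there it would
    contain both circles of [S] along [x]. *)
Lemma common_circle c :
  c <= #|S| -> (rank_circle S c \in circles D (S :\ x)) = ~~ touched S x c.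
Proof.
move=> cS; have rS := rank_lt_card xS; have rS' := ltnW rS.
apply/idP/idP => [|tc]; last first.
  rewrite rank_circle_untouched // rank_circle_in //.
  by have := card_setD1; case: ltnP; lia.
case/(circlesP cut') => d _ e; apply/negP => tc.
have [v vr] := level_attained cutS rS'; have [w wr] := level_attained cutS rS.
have [u uc] := level_attained cutS cS.
have lu : u \in rank_circle S c by rewrite inE /label uc.
have K z : rank S (level z) <= #|S| -> touched S x (rank S (level z)) ->
    z \in rank_circle S c.
  move=> zS tz; move: lu; rewrite e !inE => /eqP <-.
  by rewrite /label !rank_setD1 // label_merge ?uc // tz tc orbT.
have := label_neq.
have := K v; have := K w; rewrite vr wr /touched !inE !eqxx orbT /label vr wr.
by move=> /(_ rS isT)/eqP-> /(_ rS' isT)/eqP->; rewrite eqxx.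
Qed.

End Merge.
End Circles.

Import GRing.Theory.
Local Open Scope ring_scope.

(** * Adjacent enhanced states *)

Section Adjacent.
Variables h1 h2 : nat.
Local Notation n := (h1 + h2)%N.
Local Notation E := (mono_edge h1 h2).
Local Notation D := (@mono h1 h2).
Implicit Types (S T : {set 'I_n}) (x : 'I_n) (u v : E) (s t : enh D).

Lemma enh_eq s t : st s = st t -> neg s = neg t -> s = t.
Proof.
move=> e1 e2; apply: val_inj; move: e1 e2; rewrite /st /neg.
by case: (val s) (val t) => ? ? [? ?] /= -> ->.
Qed.

Lemma neg_sub t : neg t \subset circles D (st t).
Proof. exact: valP t. Qed.

Lemma adjacent_st x s t : adjacent_at x s t -> x \in st t /\ st s = st t :\ x.
Proof. by case/and5P=> xs /eqP-> _ _ _; rewrite setU11 setU1K. Qed.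

Lemma jdegE s : cuts_both (st s) ->
  jdeg s = #|st s|%:Z + #|st s|%:Z - 1 - (#|neg s|.*2)%:Z.
Proof.
move=> cS; have cc := card_circles cS; have := subset_leq_card (neg_sub s).
rewrite /jdeg /ideg /theta cardsD (setIidPr (neg_sub s)) cc.
by case/andP: cS; lia.
Qed.

(** Between states that cut both ladders, a new red step splits a circle, so
    that the degree condition asks for one more minus sign. *)
Lemma adjacentE x s t :
  x \in st t -> st s = st t :\ x -> cuts_both (st s) ->
  adjacent_at x s t = (#|neg t| == #|neg s|.+1)%N &&
    [forall C in circles D (st s) :&: circles D (st t),
       (C \in neg s) == (C \in neg t)].
Proof.
move=> xt es cs; rewrite /adjacent_at {1 2}es !inE eqxx /= setD1K // eqxx /=.
have ct : cuts_both (st t) by apply: (@cuts_bothD1 _ _ _ x); rewrite -?es.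
have card_t : #|st t| = #|st s|.+1 by rewrite es; apply: card_setD1.
rewrite !jdegE // /ideg card_t.
have -> : (#|st s|.+1%:Z == #|st s|%:Z + 1) by lia.
by rewrite /=; congr andb; apply/eqP/eqP; lia.
Qed.

(** The source has no minus sign by [adjacentE], and each of the two circles
    along the split step can receive the single minus sign. *)
Lemma split_targets x s t1 :
  (#|neg t1| = 1)%N -> cuts_both (st s) -> adjacent_at x s t1 ->
  (#|[set t | [&& st t == st t1, #|neg t| == 1%N & adjacent_at x s t]]| = 2)%N.
Proof.
move=> n1 cs ad; have [xt es] := adjacent_st ad; set S := st t1 in xt es *.
have cut' : cuts_both (S :\ x) by rewrite -es.
have cutS : cuts_both S := cuts_bothD1 xt cut'.
have rS := rank_lt_card xt; have rS' := ltnW rS.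
have ns : neg s = set0.
  move: ad; rewrite adjacentE // n1 => /andP[/eqP[/esym/eqP]].
  by rewrite cards_eq0 => /eqP.
have [v vr] := level_attained cutS rS'; have [w wr] := level_attained cutS rS.
have cv : circle_of D S v = rank_circle S (rank S x).
  by rewrite circle_ofE // vr.
have cw : circle_of D S w = rank_circle S (rank S x).+1.
  by rewrite circle_ofE // wr.
have ne : circle_of D S v != circle_of D S w.
  by rewrite cv cw rank_circle_eq // label_neq.
have -> : [set t | [&& st t == S, #|neg t| == 1%N & adjacent_at x s t]]
    = [set one_minus D S v; one_minus D S w].
  apply/setP => t; rewrite !inE.
  apply/and3P/orP => [[/eqP et /cards1P[C eC] adt]|].
    have CS : C \in circles D S.
      by rewrite -et; apply: (subsetP (neg_sub t)); rewrite eC set11.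
    have [c cS eCc] := circlesP cutS CS.
    have : touched S x c.
      apply: contraT => tc; move: adt.
      rewrite adjacentE ?et // => /andP[_ /forall_inP/(_ C)].
      rewrite inE es eCc common_circle // tc -eCc CS ns eC set11 inE.
      by move=> /(_ isT).
    by rewrite /touched !inE -!rank_circle_eq // -eCc -cv -cw => /orP[]/eqP e;
       [left|right]; apply/eqP/enh_eq => //; rewrite eC e.
  have good u : touched S x (rank S (level u)) -> let t' := one_minus D S u in
      [/\ st t' == S, #|neg t'| == 1%N & adjacent_at x s t'].
    move=> tu t'; have nt : #|neg t'| = 1%N by rewrite cards1.
    have et : st t' = S by [].
    split; rewrite ?nt // adjacentE ?et // nt ns cards0 /=.
    apply/forall_inP => C; rewrite inE es => /andP[C1 C2].
    have [c cS eCc] := circlesP cutS C2.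
    rewrite inE /t' /neg /= inE circle_ofE // eCc rank_circle_eq //.
    move: C1; rewrite eCc common_circle //.
    case: (eqVneq (rank_label S c) _) => // e.
    by move: tu; rewrite /touched -e => ->.
  by case=> /eqP->; apply: good; rewrite /touched ?vr ?wr !inE eqxx ?orbT.
rewrite cards2; case: eqP => // e; case/eqP: ne.
by move: (congr1 (@neg _ _ _) e) => /set1_inj.
Qed.

(** The possible sources of [t] in d of an s(a, b; C^0-): a red step [x] of
    [t] is made blue, and only the outer circle gets the sign -. *)
Section OuterMinus.
Variables (x : 'I_n) (e : E) (t : enh D).
Local Notation T := (st t).
Hypotheses (xT : x \in T) (cut' : cuts_both (T :\ x)).
Hypothesis e_outer : label (T :\ x) e = 0%N.
Let cutT : cuts_both T := cuts_bothD1 xT cut'.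
Local Notation s := (one_minus D (T :\ x) e).

Lemma adj_minusE : adjacent_at x s t = (#|neg t| == 2)%N &&
  [forall c : 'I_(#|T|.+1), ~~ touched T x c ==>
     ((rank_circle T c \in neg t) == (rank_label T c == 0%N))].
Proof.
rewrite adjacentE //; congr andb; first by rewrite /neg /= cards1.
have K c : (c <= #|T|)%N -> ~~ touched T x c ->
    (rank_circle T c \in neg s) = (rank_label T c == 0%N).
  move=> cT tc; rewrite inE circle_outer // (rank_circle_untouched xT cut') //.
  (* 0 is written as a count of steps, for [label_merge] to apply *)
  rewrite (_ : rank_circle (T :\ x) 0 =
               rank_circle (T :\ x) (0 - (rank T x < 0))) //.
  rewrite rank_circle_eq //; last first.
    by have := card_setD1 xT; have := rank_lt_card xT; case: ltnP; lia.
  by rewrite label_merge // (negbTE tc) orbF rank_label0.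
apply/forall_inP/forallP => [H c|H C].
  apply/implyP => tc; have cT : (c <= #|T|)%N by rewrite -ltnS.
  rewrite -K // eq_sym; apply: H.
  by rewrite inE common_circle // tc rank_circle_in.
rewrite inE => /andP[C1 /(circlesP cutT)[c cT eC]].
move: C1; rewrite eC common_circle // => tc.
have cT' : (c < #|T|.+1)%N by [].
by have := H (Ordinal cT'); rewrite /= tc K // eq_sym.
Qed.

(** The outer circle of [t] has sign -: either it is already a circle of the
    source, or it is one of the two parts, both with sign -, of the outer
    circle there.  The other minus sign lies on an inner circle along [x]. *)
Lemma adj_minus_interior : adjacent_at x s t -> exists j,
  [/\ (0 < j < #|T|)%N, j != rank T h1,
      neg t = [set rank_circle T 0; rank_circle T j] &
     (rank T x == j) || ((rank T x).+1 == j)].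
Proof.
rewrite adj_minusE => /andP[n2 /forallP H].
have {}H c : (c <= #|T|)%N -> ~~ touched T x c ->
    (rank_circle T c \in neg t) = (rank_label T c == 0%N).
  move=> cT tc.
  by have := H (Ordinal (cT : (c < #|T|.+1)%N)); rewrite /= tc => /eqP.
have rS := rank_lt_card xT; have rS' := ltnW rS.
have n0 : rank_circle T 0 \in neg t.
  apply: contraT => n0.
  have /subset_leqif_cards : neg t \subset
      [set rank_circle T (rank T x); rank_circle T (rank T x).+1].
    apply/subsetP => C Cn.
    have [c cT eC] := circlesP cutT (subsetP (neg_sub t) _ Cn).
    have : touched T x c.
      apply: contraNT n0 => tc; move: (Cn); rewrite eC (H c) // => c0.
      have -> : rank_circle T 0 = rank_circle T c.
        by apply/eqP; rewrite rank_circle_eq // rank_label0 eq_sym.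
      by rewrite -eC.
    by rewrite /touched !inE -!rank_circle_eq // eC.
  case=> _; rewrite (eqP n2) cards2 rank_circle_eq // label_neq // eqxx.
  move=> /esym/eqP e2.
  have t0 : touched T x 0.
    by apply: contraNT n0 => t0; rewrite H // rank_label0.
  by move: n0 t0; rewrite e2 /touched !inE -!rank_circle_eq // => /negbTE->.
have /cards1P[C eC] : #|neg t :\ rank_circle T 0| == 1%N.
  by move: n2; rewrite (cardsD1 (rank_circle T 0)) n0 add1n eqSS.
have : C \in neg t :\ rank_circle T 0 by rewrite eC set11.
rewrite !inE => /andP[C0 Cn].
have [c cT eCc] := circlesP cutT (subsetP (neg_sub t) _ Cn).
have c0 : rank_label T c != 0%N.
  by move: C0; rewrite eCc rank_circle_eq // rank_label0.
have tc : touched T x c by apply: contraTT Cn => tc; rewrite eCc H.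
have cE := label_id c0.
move: (c0); rewrite /rank_label /fuse.
case: ifP => // /negbT/norP[ca cm] c0'.
exists c; split=> //; first by rewrite lt0n c0' ltn_neqAle cm.
  by rewrite -eCc -(setD1K n0) eC.
move: tc; rewrite /touched cE !inE.
by case/orP=> /eqP e0; rewrite e0 label_id ?eqxx ?orbT // -e0 -cE.
Qed.

Lemma adj_minus_at j : (0 < j < #|T|)%N -> j != rank T h1 ->
  neg t = [set rank_circle T 0; rank_circle T j] ->
  adjacent_at x s t = (rank T x == j) || ((rank T x).+1 == j).
Proof.
move=> jb ja nt; have jE := interior_label jb ja.
have [j0 jm] := andP jb; have jm' := ltnW jm.
have nz : (j != 0)%N by rewrite -lt0n.
have n0 : rank_circle T 0 != rank_circle T j.
  by rewrite rank_circle_eq // rank_label0 jE eq_sym.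
apply/idP/idP => [/adj_minus_interior[k [kb ka]]|rj].
  rewrite nt => /setP/(_ (rank_circle T j)); rewrite !inE eqxx orbT eq_sym.
  rewrite (negbTE n0) /= rank_circle_eq // jE interior_label //.
  by move=> /esym/eqP->.
rewrite adj_minusE nt cards2 n0 /=; apply/forallP => c; apply/implyP => tc.
have cT : (c <= #|T|)%N by rewrite -ltnS.
rewrite !inE !rank_circle_eq // rank_label0.
case: (eqVneq (rank_label T c) (rank_label T j)) => [e0|_]; last by rewrite orbF.
by move: tc; rewrite /touched e0 !inE; case/orP: rj => /eqP->;
   rewrite eqxx ?orbT.
Qed.

End OuterMinus.
End Adjacent.

(** * Boundaries and classes *)

Section Boundaries.
Variables (n : nat) (E : finType) (D : diagram n E).

Lemma khd_genE (s : enh D) : khd (gen s) = khd_gen s.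
Proof.
apply/ffunP => t.
rewrite ffunE (bigD1 s) //= ffunE eqxx mul1r big1 ?addr0 // => s' ne.
by rewrite ffunE (negbTE ne) mul0r.
Qed.

Lemma Kh_class_boundary (c c' : chain D) (dc : khd c = 0) (dc' : khd c' = 0)
    i j : Kh_class dc = Kh_class dc' ->
  exists w, component i j c - component i j c' = khd w.
Proof.
move=> /(congr1 (fun f => f i j)) /eqP.
rewrite -Quotient.idealrBE => /asboolP[w _ e].
by exists w; rewrite -e.
Qed.

End Boundaries.

(** * The parity functional and the cycles *)

Section Chains.
Variables h1 h2 : nat.
Local Notation n := (h1 + h2)%N.
Local Notation E := (mono_edge h1 h2).
Local Notation D := (@mono h1 h2).
Implicit Types (S : {set 'I_n}) (x : 'I_n) (e : E) (s t : enh D).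

Definition coef_sum S (c : chain D) : int :=
  \sum_(t : enh D | (st t == S) && (#|neg t| == 1%N)) c t.

Lemma coef_sum_is_additive S : {morph coef_sum S : c c' / c - c'}.
Proof.
by move=> c c'; rewrite /coef_sum -sumrB; apply: eq_bigr => t _; rewrite !ffunE.
Qed.
HB.instance Definition _ S :=
  GRing.isZmodMorphism.Build (chain D) int (coef_sum S) (coef_sum_is_additive S).

(** For every source [s] and change crossing [x], no or two targets are
    counted, all with the same sign. *)
Lemma coef_sum_khd S w :
  (forall x, x \in S -> cuts_both (S :\ x)) -> (2 %| coef_sum S (khd w))%Z.
Proof.
move=> cutD; rewrite /coef_sum.
have -> : \sum_(t : enh D | (st t == S) && (#|neg t| == 1%N)) khd w t =
    \sum_s \sum_x
      \sum_(t | [&& st t == S, #|neg t| == 1%N & adjacent_at x s t])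
        w s * (-1) ^+ kcount s x.
  under eq_bigr do rewrite ffunE.
  rewrite exchange_big /=; apply: eq_bigr => s _.
  under eq_bigr do rewrite ffunE mulr_sumr big_mkcond.
  rewrite exchange_big /=; apply: eq_bigr => x _.
  by rewrite -big_mkcondr /=; apply: eq_bigl => t; rewrite andbA.
apply: rpred_sum => s _; apply: rpred_sum => x _; rewrite sumr_const.
pose P t := [&& st t == S, #|neg t| == 1%N & adjacent_at x s t].
case: (pickP P) => [t|no]; last by rewrite (eq_card0 no) mulr0n dvdz0.
case/and3P=> /eqP et /eqP nt ad; have [xt es] := adjacent_st ad.
have := split_targets nt _ ad; rewrite et es et cardsE => -> //.
  by apply/dvdzP; exists (w s * (-1) ^+ kcount s x); rewrite mulr_natr.
by apply: cutD; rewrite -et.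
Qed.

(** The enhanced states counted by [coef_sum S] all have the same bidegree, S
    having |S| - 1 circles. *)
Lemma coef_sum_component S i j c : cuts_both S ->
  i = #|S|%:Z -> j = #|S|%:Z + #|S|%:Z - 3 ->
  coef_sum S (component i j c) = coef_sum S c.
Proof.
move=> cS -> ->; apply: eq_bigr => t /andP[/eqP et /eqP nt]; rewrite ffunE.
by rewrite jdegE ?et // /ideg et nt eqxx /=; case: eqP => //; lia.
Qed.

Lemma separated S (c c' : chain D) (dc : khd c = 0) (dc' : khd c' = 0) :
  (forall x, x \in S -> cuts_both (S :\ x)) -> cuts_both S ->
  ~~ (2 %| coef_sum S c - coef_sum S c')%Z -> Kh_class dc <> Kh_class dc'.
Proof.
move=> cutD cS; apply: contraNnot => e.
have [w ew] := Kh_class_boundary #|S|%:Z (#|S|%:Z + #|S|%:Z - 3) e.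
have := coef_sum_khd w cutD.
by rewrite -ew raddfB /= !coef_sum_component.
Qed.

(** [a] red steps in H_1 and [b] in H_2 *)
Definition has_size (a b : nat) S := (rank S h1 == a) && (#|S| == a + b)%N.

Lemma has_size_cuts a b S :
  (0 < a)%N -> (0 < b)%N -> has_size a b S -> cuts_both S.
Proof.
by move=> a0 b0 /andP[/eqP ra /eqP cS]; rewrite /cuts_both ra cS; lia.
Qed.

Lemma mono_state_size (M1 : {set 'I_h1}) (M2 : {set 'I_h2}) a b :
  has_size a b (mono_state M1 M2) = (#|M1| == a) && (#|M2| == b).
Proof.
have cS : #|mono_state M1 M2| = (#|M1| + #|M2|)%N.
  rewrite cardsU (_ : _ :&: _ = set0) ?cards0 ?subn0; last first.
    apply/setP => y; rewrite !inE; apply/negP.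
    by case/andP=> /imsetP[k _ ->] /imsetP[l _] /eqP; rewrite eq_lrshift.
  by rewrite !card_imset //; [apply: rshift_inj | apply: lshift_inj].
have rS : rank (mono_state M1 M2) h1 = #|M1|.
  rewrite -(card_imset _ (@lshift_inj h1 h2)).
  apply: eq_card => y; rewrite !inE.
  apply/andP/idP => [[/orP[//|/imsetP[k _ ->]]]|yM].
    by rewrite /= ltnNge leq_addr.
  by rewrite yM; case/imsetP: yM => k _ -> /=.
by rewrite /has_size cS rS; case: eqP => // ->; rewrite eqn_add2l.
Qed.

Lemma lshift_mono_state (M1 : {set 'I_h1}) (M2 : {set 'I_h2}) k :
  (lshift h2 k \in mono_state M1 M2) = (k \in M1).
Proof.
rewrite inE (mem_imset _ _ (@lshift_inj h1 h2)); case: (k \in M1) => //=.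
by apply/negP => /imsetP[l _] /eqP; rewrite eq_lrshift.
Qed.

Lemma rshift_mono_state (M1 : {set 'I_h1}) (M2 : {set 'I_h2}) k :
  (rshift h1 k \in mono_state M1 M2) = (k \in M2).
Proof.
rewrite inE orbC (mem_imset _ _ (@rshift_inj h1 h2)); case: (k \in M2) => //=.
by apply/negP => /imsetP[l _] /eqP; rewrite eq_rlshift.
Qed.

Lemma mono_stateK S :
  mono_state [set k | lshift h2 k \in S] [set k | rshift h1 k \in S] = S.
Proof.
apply/setP => y; rewrite -(splitK y); case: (split y) => k /=.
  by rewrite lshift_mono_state inE.
by rewrite rshift_mono_state inE.
Qed.

Lemma mono_sumE a b e :
  mono_sum a b e = \sum_(S | has_size a b S) gen (one_minus D S e).
Proof.
pose parts S := ([set k | lshift h2 k \in S], [set k | rshift h1 k \in S]).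
rewrite /mono_sum pair_big_dep /= (reindex parts) /=.
  apply: eq_big => [S|S _]; last by rewrite mono_stateK.
  by rewrite -mono_state_size mono_stateK.
exists (fun M => mono_state M.1 M.2) => [S _|[M1 M2] _]; first exact: mono_stateK.
congr pair; apply/setP => k; rewrite inE.
  exact: lshift_mono_state.
exact: rshift_mono_state.
Qed.

Lemma coef_sum_mono_sum S a b e :
  coef_sum S (mono_sum a b e) = (has_size a b S)%:R.
Proof.
have g S' : coef_sum S (gen (one_minus D S' e)) = (S' == S)%:R.
  rewrite /coef_sum; case: eqP => [->|ne]; last first.
    rewrite big1 // => t /andP[/eqP et _]; rewrite ffunE; case: eqP => // e'.
    by case: ne; rewrite -et e'.
  rewrite (bigD1 (one_minus D S e)) /=; last by rewrite eqxx /neg /= cards1.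
  rewrite ffunE eqxx big1 ?addr0 // => t /andP[_ ne].
  by rewrite ffunE (negbTE ne).
rewrite mono_sumE raddf_sum /=; under eq_bigr do rewrite g.
case: (boolP (has_size a b S)) => sz.
  by rewrite (bigD1 S) //= eqxx big1 ?addr0 // => S' /andP[_ /negbTE->].
by rewrite big1 // => S' sz'; case: eqP => // e'; rewrite -e' sz' in sz.
Qed.

Lemma kcount_setD1 S x e : kcount (one_minus D (S :\ x) e) x = rank S x.
Proof.
apply: eq_card => y; rewrite !inE /=.
case: (ltnP y x) => yx //=; last by rewrite andbF.
by rewrite andbT; case: eqP yx => [->|]; rewrite ?ltnn.
Qed.

(** A target [t] has its inner minus sign on the circle of rank [j], between
    the red steps of ranks [j.-1] and [j].  Both lie in the same ladder, so
    that both or none of the two sources occur in the sum; their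
    contributions are opposite. *)
Lemma khd_mono_sum a b e : (0 < a)%N -> (0 < b)%N ->
  (forall S, cuts_both S -> label S e = 0%N) -> khd (mono_sum a b e) = 0.
Proof.
move=> a0 b0 le; rewrite mono_sumE raddf_sum /=; apply/ffunP => t.
rewrite sum_ffunE [RHS]ffunE.
pose Q x := [&& x \in st t, has_size a b (st t :\ x) &
               adjacent_at x (one_minus D (st t :\ x) e) t].
have -> : \sum_(S | has_size a b S) khd (gen (one_minus D S e)) t =
    \sum_(x | Q x) (-1) ^+ rank (st t) x.
  under eq_bigr do rewrite khd_genE ffunE big_mkcond.
  rewrite exchange_big [RHS]big_mkcond /=; apply: eq_bigr => x _.
  have no S : adjacent_at x (one_minus D S e) t ->
      x \in st t /\ S = st t :\ x by case/adjacent_st.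
  rewrite /Q; case: (boolP (x \in st t)) => xT /=; last first.
    by rewrite big1 // => S _; case: ifP => // /no[xT']; rewrite xT' in xT.
  rewrite big_mkcond (bigD1 (st t :\ x)) //= big1 ?addr0; last first.
    move=> S ne; do 2 case: ifP => //.
    by move=> /no[_ e'] _; rewrite e' eqxx in ne.
  by rewrite kcount_setD1; case: (has_size _ _ _).
case: (pickP Q) => [x0 /and3P[x0T sz0 ad0]|no]; last exact: big_pred0.
have cut0 := has_size_cuts a0 b0 sz0.
have [j [jb ja nt rx0]] := adj_minus_interior x0T cut0 (le _ cut0) ad0.
have [j0 jm] := andP jb.
have [x2 x2T r2] := rank_nth jm.
have [x1 x1T r1] := rank_nth (leq_ltn_trans (leq_pred j) jm).
have szE x : x \in st t ->
    (rank (st t) x == j) || ((rank (st t) x).+1 == j) ->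
    has_size a b (st t :\ x).
  move=> xT rx; move: sz0; rewrite /has_size !rank_setD1 //.
  (* [x0] and [x] lie in the same ladder, as [j] is not the number of red
     steps of H_1 *)
  have -> : (rank (st t) x0 < rank (st t) h1)%N =
            (rank (st t) x < rank (st t) h1)%N by move: rx rx0 ja; lia.
  by have := card_setD1 xT; rewrite (card_setD1 x0T) => -[->].
have QE x : Q x = (x == x1) || (x == x2).
  apply/and3P/idP => [[xT sz]|].
    have cut := has_size_cuts a0 b0 sz.
    rewrite (adj_minus_at xT cut (le _ cut) jb ja nt) => rx.
    case/orP: rx => /eqP rx; apply/orP; [right|left];
      apply/eqP/(@rank_inj _ (st t)) => //=; first by rewrite r2.
    by rewrite r1 -rx.
  have QI y : y \in st t -> (rank (st t) y == j) || ((rank (st t) y).+1 == j) ->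
      [/\ y \in st t, has_size a b (st t :\ y) &
          adjacent_at y (one_minus D (st t :\ y) e) t].
    move=> yT ry; have sz := szE _ yT ry; have cut := has_size_cuts a0 b0 sz.
    by rewrite (adj_minus_at yT cut (le _ cut) jb ja nt); split.
  by case/orP=> /eqP->; apply: QI; rewrite // ?r1 ?r2 ?prednK ?eqxx ?orbT.
have ne : x1 != x2.
  by apply/eqP => e12; move: r1; rewrite e12 r2; lia.
rewrite (eq_bigl _ _ QE) (bigD1 x1) ?eqxx //= (bigD1 x2) /=; last first.
  by rewrite eqxx orbT eq_sym.
rewrite big1 ?addr0; last by move=> x; case: (x == x1); case: (x == x2).
by rewrite r1 r2 -{2}(prednK j0) exprS mulN1r subrr.
Qed.

Lemma label_outer S : cuts_both S ->
  label S (top h1 h2 0) = 0%N /\ label S (lft h1 h2 0) = 0%N.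
Proof.
move=> cS; rewrite label_top // label_lft // rank0 rank_label0 addn0.
by rewrite rank_label_h1.
Qed.

Lemma has_size_exists a b :
  (a <= h1)%N -> (b <= h2)%N -> exists S, has_size a b S.
Proof.
have sub k m : (k <= m)%N -> exists M : {set 'I_m}, #|M| == k.
  move=> km; exists [set widen_ord km i | i in [set: 'I_k]].
  rewrite card_imset ?cardsT ?card_ord // => i l e.
  by apply: val_inj; apply: (congr1 val e).
move=> /sub[M1 m1] /sub[M2 m2]; exists (mono_state M1 M2).
by rewrite mono_state_size m1.
Qed.

End Chains.

(** * Separating the torsion classes *)

Theorem proposition16 (h1 h2 mu1 mu2 : nat)
    (h1_ge2 : (2 <= h1)%N) (h2_ge2 : (2 <= h2)%N)
    (mu1_bounds : (2 <= mu1 <= h1)%N) (mu2_bounds : (2 <= mu2 <= h2)%N)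
    (mu_even : (~~ odd mu1 /\ (mu1 < h1)%N) \/ (~~ odd mu2 /\ (mu2 < h2)%N)) :
  (forall mu : nat, (1 <= mu)%N -> odd mu -> (mu < h1)%N ->
     exists (dV : khd (V h1 h2 mu1 mu2) = 0) (dV' : khd (V_right0 h1 h2 mu) = 0),
       Kh_class dV <> Kh_class dV') /\
  (forall mu : nat, (1 <= mu)%N -> odd mu -> (mu < h2)%N ->
     exists (dV : khd (V h1 h2 mu1 mu2) = 0) (dV' : khd (V_left0 h1 h2 mu) = 0),
       Kh_class dV <> Kh_class dV').
Proof.
have [m1 m1h] := andP mu1_bounds; have [m2 m2h] := andP mu2_bounds.
have d1 a b : (0 < a)%N -> (0 < b)%N -> khd (sum_C1 h1 h2 a b) = 0.
  by move=> a0 b0; apply: khd_mono_sum => // S /label_outer[].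
have d2 a b : (0 < a)%N -> (0 < b)%N -> khd (sum_C2 h1 h2 a b) = 0.
  by move=> a0 b0; apply: khd_mono_sum => // S /label_outer[].
have p1 : (0 < mu1)%N by apply: leq_trans m1.
have p2 : (0 < mu2)%N by apply: leq_trans m2.
have dV : khd (V h1 h2 mu1 mu2) = 0.
  rewrite /V raddfD /= -[RHS]addr0; congr (_ + _); case: ifP => _.
  - exact: d1.
  - exact: raddf0.
  - by rewrite raddfMz /= (d2 _ _ p1 (ltn0Sn _)) mul0rz.
  - exact: raddf0.
(* the numbers of red steps in a term present in V(mu1, mu2); the other term,
   if present, has other numbers of red steps *)
have [a [b [a2 b2 VS]]] : exists a b, [/\ (2 <= a <= h1)%N, (2 <= b <= h2)%N &
   forall S, has_size a b S -> coef_sum S (V h1 h2 mu1 mu2) \in [:: 1; -1]].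
  rewrite /V; case: ifP => c1.
    case/andP: c1 => _ lt1; exists mu1.+1, mu2; split; try lia.
    move=> S sz; rewrite raddfD /= coef_sum_mono_sum sz.
    have nsz : has_size mu1 mu2.+1 S = false.
      by apply: contraTF sz => /andP[/eqP r _]; rewrite /has_size r; lia.
    case: ifP => _; last by rewrite raddf0 addr0.
    by rewrite raddfMz /= coef_sum_mono_sum nsz mul0rz addr0.
  case: mu_even => [[o1 l1]|[o2 l2]]; first by rewrite o1 l1 in c1.
  exists mu1, mu2.+1; split; try lia.
  move=> S sz; rewrite o2 l2 raddfD /= raddf0 add0r raddfMz /=.
  by rewrite coef_sum_mono_sum sz -signr_odd; case: (odd mu1).
have [ah bh] : (a <= h1)%N /\ (b <= h2)%N by lia.
have [S sz] := has_size_exists ah bh; have {VS}cV := VS _ sz.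
have cutD x : x \in S -> cuts_both (S :\ x).
  move=> xS; rewrite /cuts_both rank_setD1 //; have := card_setD1 xS.
  case/andP: sz => /eqP-> /eqP->; move: a2 b2 #|S :\ x|; clear => a2 b2 m.
  by case: (_ < a)%N; lia.
have cS : cuts_both S by apply: has_size_cuts sz; lia.
have sep (c : chain _) (dc : khd c = 0) :
    coef_sum S c = 0 -> Kh_class dV <> Kh_class dc.
  move=> c0; apply: (separated cutD cS); rewrite c0 subr0.
  by move: cV; rewrite !inE => /orP[]/eqP->.
have single a' b' : (a' == 1)%N || (b' == 1)%N -> has_size a' b' S = false.
  by case/andP: sz => /eqP r /eqP c; rewrite /has_size r c; lia.
split=> mu mu_pos mu_odd mu_lt.
  have dV' : khd (V_right0 h1 h2 mu) = 0.
    by rewrite /V_right0 raddfMz /= d1 // mul0rz.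
  exists dV, dV'; apply: sep; rewrite raddfMz /= coef_sum_mono_sum.
  by rewrite single ?orbT ?mul0rz.
have dV' : khd (V_left0 h1 h2 mu) = 0 by apply: d2.
by exists dV, dV'; apply: sep; rewrite coef_sum_mono_sum single.
Qed.
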